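(* Let $F\in\mathfrak{qc}(\widehat{\mathsf k}\otimes\mathfrak h)$. Then $F$ enjoys a unique decomposition $$F=F_{\mathrm{wn\text{-}g}}\boxplus F_{\mathrm{mg}}$$ where, for some orthogonal decomposition $\mathsf k=\mathsf k_1\oplus\mathsf k_2$, $F_{\mathrm{wn\text{-}g}}$ is a wholly non-Gaussian element of $\mathfrak{qc}(\widehat{\mathsf k_1}\otimes\mathfrak h)$ and $F_{\mathrm{mg}}$ is a pure Gaussian element of $\mathfrak{qc}(\widehat{\mathsf k_2}\otimes\mathfrak h)$.
   Context: All Hilbert spaces are complex. $\mathfrak h$ and $\mathsf k$ are Hilbert spaces. For any Hilbert space $\mathsf k$, $\widehat{\mathsf k}:=\mathbb C\oplus\mathsf k$, so that $\widehat{\mathsf k}\otimes\mathfrak h=\mathfrak h\oplus(\mathsf k\otimes\mathfrak h)$, with operators on it written as block matrices; $\Delta$ is the orthogonal projection onto $\mathsf k\otimes\mathfrak h$, $\Delta^\perp=I-\Delta$, and $F_1\lhd F_2:=F_1+F_1\Delta F_2+F_2$ for $F_1,F_2\in B(\widehat{\mathsf k}\otimes\mathfrak h)$. Set $\mathfrak c(\widehat{\mathsf k}\otimes\mathfrak h):=\{F\in B(\widehat{\mathsf k}\otimes\mathfrak h):F^*\lhd F\le0\}$ and $\mathfrak{qc}(\widehat{\mathsf k}\otimes\mathfrak h):=\mathfrak c(\widehat{\mathsf k}\otimes\mathfrak h)+\mathbb R_+\Delta^\perp$. If $F=\begin{bmatrix}K&M\\L&C-I\end{bmatrix}\in\mathfrak{qc}(\widehat{\mathsf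 k}\otimes\mathfrak h)$ then $C$ is a contraction. For a contraction $C\in B(\mathsf k\otimes\mathfrak h)$ set $$\mathsf k^C_{\mathrm p}:=\overline{\mathrm{Lin}}\{(I_{\mathsf k}\otimes\langle u|)\xi:\xi\in\mathrm{Ran}(C-I)^*,\,u\in\mathfrak h\}\subset\mathsf k .$$ An element $F=\begin{bmatrix}K&M\\L&C-I\end{bmatrix}$ of $\mathfrak{qc}(\widehat{\mathsf k}\otimes\mathfrak h)$ is wholly non-Gaussian if $\mathsf k^C_{\mathrm p}=\mathsf k$; it is pure Gaussian if it has the form $\begin{bmatrix}-\frac12L^*L&-L^*\\L&0\end{bmatrix}$ for some $L\in B(\mathfrak h;\mathsf k\otimes\mathfrak h)$. The same definitions apply with $\mathsf k$ replaced by $\mathsf k_1$ or $\mathsf k_2$. For an orthogonal decomposition $\mathsf k=\mathsf k_1\oplus\mathsf k_2$ and $F_i=\begin{bmatrix}K_i&M_i\\L_i&N_i\end{bmatrix}\in B(\widehat{\mathsf k_i}\otimes\mathfrak h)$ ($i=1,2$), the concatenation product is $$F_1\boxplus F_2:=\begin{bmatrix}K_1+K_2&M_1&M_2\\L_1&N_1&0\\L_2&0&N_2\end{bmatrix}\in B\big(\mathfrak h\oplus(\mathsf k_1\otimes\mathfrak h)\oplus(\mathsf k_2\otimes\mathfrak h)\big)=B(\widehat{\mathsf k}\otimes\mathfrak h).$$ Uniqueness means that the orthogonal decomposition $\mathsf k=\mathsf k_1\oplus\mathsf k_2$ and the two components are uniquely determined by $F$. *)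

(* Defs.v *)
From HB Require Import structures.
From mathcomp Require Import all_boot all_order all_algebra.
From mathcomp Require Import complex.
From mathcomp Require Import all_classical all_reals.
From mathcomp Require Import topology normedtype.
From mathcomp Require Import ring lra.

Set Implicit Arguments.
Unset Strict Implicit.
Unset Printing Implicit Defensive.

Import Order.TTheory GRing.Theory Num.Theory.
Import numFieldNormedType.Exports.

Local Open Scope classical_set_scope.
Local Open Scope ring_scope.

(* The inner product is linear in its first argument. *)
HB.mixin Record CompleteNormedModule_isHilbert (R : realType) V
    & CompleteNormedModule R[i] V := {
  hdot : {dot V for (@Num.conj R[i])} ;
  hdotE : forall x : V, hdot x x = `|x| ^+ 2
}.

#[short(type="hilbertType")]
HB.structure Definition Hilbert (R : realType) :=
  {V of CompleteNormedModule R[i] V & CompleteNormedModule_isHilbert R V}.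

Section inner_product_theory.
Variables (C : numClosedFieldType) (V : lmodType C).
Variable form : {dot V for (@Num.conj C)}.
Local Notation "''[' u , v ]" := (form u v) : ring_scope.
Local Notation "''[' u ]" := (form u u) : ring_scope.

Lemma dot_conj u v : '[u, v] = ('[v, u])^*.
Proof. by rewrite hermC /= mul1r. Qed.

Lemma cauchy_schwarz u v : `|'[u, v]| ^+ 2 <= '[u] * '[v].
Proof.
have [->|v0] := eqVneq v 0.
  by rewrite !linear0r normr0 expr0n mulr0.
have vgt0 : 0 < '[v] by rewrite dnorm_gt0.
pose a := '[u, v] / '[v].
have av : a * '[v] = '[u, v] by rewrite divfK ?gt_eqF.
have := dnorm_ge0 form (u - a *: v).
rewrite dnormB dnormZ linearZr_LR /= -/a.
have -> : a^* * '[u, v] = `|a| ^+ 2 * '[v].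
  by rewrite -av mulrA [a^* * a]mulrC -normCK.
have -> : (`|a| ^+ 2 * '[v])^* = `|a| ^+ 2 * '[v].
  by rewrite geC0_conj// mulr_ge0 ?exprn_ge0// ltW.
move=> h; have {}h : `|a| ^+ 2 * '[v] <= '[u].
  by rewrite -subr_ge0; apply: le_trans h _; rewrite le_eqVlt; apply/orP; left; apply/eqP; ring.
rewrite -av normrM exprMn (gtr0_norm vgt0) expr2 mulrA ler_pM2r//.
Qed.

Lemma dot_norm_triangle u v : sqrtC '[u + v] <= sqrtC '[u] + sqrtC '[v].
Proof.
rewrite -ler_sqr ?nnegrE ?addr_ge0 ?sqrt_dnorm_ge0//.
rewrite sqrrD !sqrtCK dnormD addrAC lerD2r.
rewrite lerD2l.
have -> : '[u, v] + '[u, v]^* = 'Re '[u, v] *+ 2.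
  by rewrite ReE -mulr_natr divfK// pnatr_eq0.
rewrite lerMn2r/=.
apply: (le_trans (leif_Re_Creal _).1).
rewrite -ler_sqr ?nnegrE ?mulr_ge0 ?sqrt_dnorm_ge0//.
by rewrite exprMn !sqrtCK cauchy_schwarz.
Qed.

End inner_product_theory.

Notation "''[' x , y ]" := (hdot x y)
  (at level 0, format "''[' x ,  y ]") : ring_scope.

Section hilbert_theory.
Variables (R : realType) (V : hilbertType R).
Implicit Types (x y z : V) (a : R[i]).

Lemma hdot_conj x y : '[x, y] = ('[y, x])^*.
Proof. exact: dot_conj. Qed.

Lemma hdotDl x y z : '[x + y, z] = '[x, z] + '[y, z].
Proof. exact: linearDl. Qed.

Lemma hdotDr x y z : '[x, y + z] = '[x, y] + '[x, z].
Proof. exact: linearDr. Qed.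

Lemma hdotZl a x y : '[a *: x, y] = a * '[x, y].
Proof. exact: linearZl_LR. Qed.

Lemma hdotZr a x y : '[x, a *: y] = a^* * '[x, y].
Proof. exact: linearZr_LR. Qed.

Lemma hdotBl x y z : '[x - y, z] = '[x, z] - '[y, z].
Proof. exact: linearBl. Qed.

Lemma hdotBr x y z : '[x, y - z] = '[x, y] - '[x, z].
Proof. exact: linearBr. Qed.

Lemma hdot0l x : '[0, x] = 0. Proof. exact: linear0l. Qed.

Lemma hdot0r x : '[x, 0] = 0. Proof. exact: linear0r. Qed.

Lemma hdot_le x y : `|'[x, y]| <= `|x| * `|y|.
Proof.
rewrite -ler_sqr ?nnegrE ?mulr_ge0//.
by rewrite exprMn -!hdotE; exact: cauchy_schwarz.
Qed.

Lemma hdot_eqP x y : (forall z, '[z, x] = '[z, y]) -> x = y.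
Proof.
move=> h; apply/eqP; rewrite -subr_eq0 -normr_eq0 -sqrf_eq0 -hdotE.
by rewrite hdotBr h subrr.
Qed.

Definition nrm x : R := complex.Re `|x|.

Lemma nrmE x : `|x| = ((nrm x)%:C)%C.
Proof. by rewrite /nrm RRe_real// ger0_real. Qed.

Lemma nrm_ge0 x : 0 <= nrm x.
Proof. by rewrite -ler0c -nrmE. Qed.

End hilbert_theory.

Section bounded_operators.
Variables (R : realType) (X Y : hilbertType R).

Definition bop_pred : {pred X -> Y} :=
  mem [set f : X -> Y | linear f /\ continuous f].

Record bop := Bop { bop_fun :> X -> Y ; bop_mem : bop_fun \in bop_pred }.

HB.instance Definition _ := [isSub for bop_fun].
HB.instance Definition _ := [Choice of bop by <:].

Lemma bop_linear (A : bop) : linear A.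
Proof. by have := bop_mem A; rewrite inE => -[]. Qed.

Lemma bop_continuous (A : bop) : continuous A.
Proof. by have := bop_mem A; rewrite inE => -[]. Qed.

HB.instance Definition _ (A : bop) :=
  GRing.isLinear.Build R[i] X Y *:%R (bop_fun A) (bop_linear A).

Lemma bopP (A B : bop) : A = B <-> A =1 B.
Proof. by split=> [->//|AB]; apply/val_inj/funext. Qed.

Lemma bop_bounded (A : bop) : exists2 M : R, 0 <= M &
  forall x, nrm (A x) <= M * nrm x.
Proof.
have /(linear_bounded_continuous (bop_fun A : {linear X -> Y})) := @bop_continuous A.
move=> /linear_boundedP/pinfty_ex_gt0[M M0 AM].
have Mr : M = ((complex.Re M)%:C)%C by rewrite RRe_real// gtr0_real.
exists (complex.Re M) => [|x]; first by rewrite -ler0c -Mr ltW.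
by have := AM x; rewrite Mr !nrmE -rmorphM/= lecR.
Qed.

Lemma bop_subproof (f : X -> Y) (M : R) : linear f ->
  (forall x, `|f x| <= (M%:C)%C * `|x|) -> f \in bop_pred.
Proof.
move=> lf fM; rewrite inE; split=> //=.
pose l := GRing.isLinear.Build R[i] X Y *:%R f lf.
pose F : {linear X -> Y} := HB.pack f l.
apply: (@bounded_linear_continuous R[i] X Y F).
apply/linear_boundedP; near=> r => x.
apply: (le_trans (fM x)); apply: ler_wpM2r => //.
by near: r; apply: nbhs_pinfty_ge; rewrite complex_real.
Unshelve. all: by end_near. Qed.

Lemma bop_submod_closed : submod_closed bop_pred.
Proof.
split; rewrite ?inE /=.
  split=> [a x y|x]; last exact: cvg_cst.
  by rewrite -[0]/(cst 0) /cst scaler0 addr0.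
move=> a f g; rewrite !inE => -[lf cf] [lg cg]; split=> [b x y|x].
  rewrite -[LHS]/(a *: f _ + g _) -[in RHS]/(a *: f x + g x).
  rewrite lf lg !scalerDr !scalerA mulrC -!addrA; congr (_ + _).
  by rewrite addrCA.
exact: (@cvgD _ Y X (nbhs x) _ (a *: f) g _ _ (cvgZl_tmp (cf x)) (cg x)).
Qed.

HB.instance Definition _ :=
  GRing.isSubmodClosed.Build _ _ bop_pred bop_submod_closed.
HB.instance Definition _ := [SubChoice_isSubLmodule of bop by <:].

End bounded_operators.
Arguments bop_pred {R} X Y _.

Section hilbert_real.
Variables (R : realType) (V : hilbertType R).
Implicit Types (x y z : V) (r : R).

Lemma ReM_real r (z : R[i]) : complex.Re ((r%:C)%C * z) = r * complex.Re z.
Proof. by case: z => a b /=; rewrite mul0r subr0. Qed.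

Lemma Re_conj_c (z : R[i]) : complex.Re (z^*) = complex.Re z.
Proof. by case: z. Qed.

Lemma Re_le_norm (z : R[i]) (r : R) : `|z| <= (r%:C)%C -> `|complex.Re z| <= r.
Proof.
rewrite normc_def lecR; apply: le_trans.
by rewrite -sqrtr_sqr ler_wsqrtr// lerDl sqr_ge0.
Qed.

Lemma nrm_sqr x : ((nrm x ^+ 2)%:C)%C = '[x, x].
Proof. by rewrite rmorphXn/= -nrmE -hdotE. Qed.

Lemma nrm_sqrE x : nrm x ^+ 2 = complex.Re '[x, x].
Proof. by rewrite -nrm_sqr. Qed.

Lemma nrmD_sqr x y :
  nrm (x + y) ^+ 2 = nrm x ^+ 2 + nrm y ^+ 2 + 2 * complex.Re '[x, y].
Proof.
rewrite !nrm_sqrE hdotDl !hdotDr !raddfD/= (hdot_conj y x) Re_conj_c.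
ring.
Qed.

Lemma nrmN x : nrm (- x) = nrm x.
Proof. by rewrite /nrm normrN. Qed.

Lemma nrmZ_real r x : nrm ((r%:C)%C *: x) = `|r| * nrm x.
Proof.
rewrite {1}/nrm normrZ; have -> : `|(r%:C)%C| = (`|r|%:C)%C :> R[i].
  by rewrite normc_def/= expr0n addr0 sqrtr_sqr.
by rewrite ReM_real.
Qed.

Lemma nrmB_sqr x y :
  nrm (x - y) ^+ 2 = nrm x ^+ 2 + nrm y ^+ 2 - 2 * complex.Re '[x, y].
Proof. by rewrite nrmD_sqr nrmN -scaleN1r hdotZr rmorphN1 mulN1r raddfN mulrN. Qed.

Lemma Re_hdot_le x y : `|complex.Re '[x, y]| <= nrm x * nrm y.
Proof. by apply: Re_le_norm; rewrite rmorphM/= -!nrmE; exact: hdot_le. Qed.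

Lemma riesz (f : {scalar V}) (M : R) : 0 <= M ->
  (forall x, `|f x| <= (M%:C)%C * `|x|) -> exists y, forall x, f x = '[x, y].
Proof.
move=> M0 fM.
have RefM x : `|complex.Re (f x)| <= M * nrm x.
  by apply: Re_le_norm; rewrite rmorphM/= -nrmE.
pose J x := nrm x ^+ 2 - 2 * complex.Re (f x).
have Jlb x : - M ^+ 2 <= J x.
  have /ler_normlP[_ h] := RefM x; rewrite /J.
  have := sqr_ge0 (nrm x - M); lra.
have Jinf : has_inf (range J).
  by split; [exists (J 0); exists 0|exists (- M ^+ 2) => _ [x _ <-]].
pose m := inf (range J).
have mJ x : m <= J x by apply: ge_inf; [exact: Jinf.2|exists x].
have Jm e : 0 < e -> exists x, J x < m + e.
  by move=> e0; have [_ [x _ <-]] := inf_adherent e0 Jinf; exists x.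
pose F := filter_from [set e : R | 0 < e] (fun e => [set x | J x < m + e]).
have FF : ProperFilter F.
  apply: filter_from_proper => [|e /= e0]; last exact: Jm.
  apply: filter_from_filter; first by exists 1 => /=.
  move=> d e /= d0 e0; exists (Num.min d e); first by rewrite lt_min d0.
  move=> x /= xm; split=> /=; apply: (lt_le_trans xm).
    by rewrite lerD2l ge_min lexx.
  by rewrite lerD2l ge_min lexx orbT.
have half : 2^-1 = ((2^-1 : R)%:C)%C :> R[i].
  by rewrite fmorphV rmorph_nat.
have fZ r x : complex.Re (f ((r%:C)%C *: x)) = r * complex.Re (f x).
  by rewrite -ReM_real (linearZ_LR f).
have Jpar x y : nrm (x - y) ^+ 2 <= 2 * (J x + J y) - 4 * m.
  have := mJ (2^-1 *: (x + y)); rewrite /J half nrmZ_real exprMn fZ.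
  rewrite linearD raddfD/= (nrmD_sqr x y) (nrmB_sqr x y) real_normK ?num_real//.
  by lra.
have cF : cauchy F.
  apply/cauchy_ballP => e e0.
  pose r := complex.Re e.
  have er : e = (r%:C)%C by rewrite RRe_real// gtr0_real.
  have r0 : 0 < r by rewrite -ltcR -er.
  have Fr : F [set x | J x < m + r ^+ 2 / 4].
    by exists (r ^+ 2 / 4) => //=; rewrite divr_gt0// exprn_gt0.
  exists ([set x | J x < m + r ^+ 2 / 4], [set x | J x < m + r ^+ 2 / 4]) => //.
  move=> [x y] /= [Jx Jy]; rewrite -ball_normE/= er nrmE ltcR.
  rewrite -(@ltr_pXn2r _ 2) ?nnegrE ?nrm_ge0 ?ltW//.
  by apply: (le_lt_trans (Jpar x y)); lra.
have Fl : F --> lim F by exact: cauchy_cvg.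
move: (lim F) Fl => l Fl.
have Jl : J l <= m.
  rewrite leNgt; apply/negP => ml.
  pose K := 2 * (nrm l + M) + 1.
  have K0 : 0 < K by have := nrm_ge0 l; rewrite /K; lra.
  pose e := (J l - m) / 2 / K.
  have e0 : 0 < e by rewrite !divr_gt0// subr_gt0.
  have [] : exists x, nrm (l - x) < e /\ J x < m + (J l - m) / 2.
    have := (@fcvgrPdist_lt _ _ F (@filter_filter _ _ FF) l).1 Fl (e%:C)%C; rewrite ltcR => /(_ e0) [d d0 dl].
    have [x xJ] : exists x, J x < m + Num.min d ((J l - m) / 2).
      by apply: Jm; rewrite lt_min d0 divr_gt0// subr_gt0.
    exists x; split.
      rewrite -ltcR -nrmE; apply: dl => /=; apply: (lt_le_trans xJ).
      by rewrite lerD2l ge_min lexx.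
    by apply: (lt_le_trans xJ); rewrite lerD2l ge_min lexx orbT.
  move=> x [lx Jx].
  have hJ : J l <= J x + 2 * (nrm l + M) * nrm (l - x).
    have xE : x = l - (l - x) by rewrite opprB addrC subrK.
    rewrite {1}/J.
    have -> : J x = nrm l ^+ 2 + nrm (l - x) ^+ 2
        - 2 * complex.Re '[l, l - x] - 2 * complex.Re (f l) + 2 * complex.Re (f (l - x)).
      rewrite [in LHS]xE /J nrmB_sqr linearB raddfB/=; ring.
    have /ler_normlP[_ h1] := Re_hdot_le l (l - x).
    have /ler_normlP[h2 _] := RefM (l - x).
    have := sqr_ge0 (nrm (l - x)); lra.
  have : 2 * (nrm l + M) * nrm (l - x) <= (J l - m) / 2.
    have -> : (J l - m) / 2 = K * e by rewrite /e [RHS]mulrC divfK// gt_eqF.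
    have lM : 0 <= 2 * (nrm l + M) by rewrite mulr_ge0// addr_ge0// nrm_ge0.
    apply: (le_trans (ler_wpM2l lM (ltW lx))).
    by rewrite ler_wpM2r ?(ltW e0)// /K lerDl.
  lra.
have Re0 d : complex.Re '[l, d] = complex.Re (f d).
  pose g := complex.Re '[l, d] - complex.Re (f d).
  have hg t : 0 <= t ^+ 2 * nrm d ^+ 2 + 2 * t * g.
    have := le_trans Jl (mJ (l + (t%:C)%C *: d)).
    rewrite /J nrmD_sqr nrmZ_real hdotZr linearD raddfD/= fZ.
    rewrite exprMn real_normK ?num_real//.
    have -> : ((t%:C)%C : R[i])^* = (t%:C)%C by rewrite conj_Creal// complex_real.
    rewrite !ReM_real /g; lra.
  apply/eqP; rewrite -subr_eq0 -/g; apply/eqP.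
  have [d0|d0] := eqVneq (nrm d) 0.
    have := hg 1; have := hg (-1); rewrite d0; lra.
  have D0 : 0 < nrm d ^+ 2 by rewrite exprn_even_gt0.
  have := hg (- g / nrm d ^+ 2).
  have -> : (- g / nrm d ^+ 2) ^+ 2 * nrm d ^+ 2 + 2 * (- g / nrm d ^+ 2) * g
     = - (g ^+ 2 / nrm d ^+ 2) by field.
  rewrite oppr_ge0 pmulr_lle0 ?invr_gt0// => h.
  by apply/eqP; rewrite -sqrf_eq0 eq_le h sqr_ge0.
exists l => x.
have h1 : complex.Re (f x) = complex.Re '[x, l].
  by rewrite (hdot_conj x l) Re_conj_c Re0.
have : complex.Re (f ('i%C *: x)) = complex.Re '['i%C *: x, l].
  by rewrite (hdot_conj _ l) Re_conj_c Re0.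
rewrite (linearZ_LR f) hdotZl mulrC [X in _ = complex.Re X]mulrC !ReiNIm.
move=> /oppr_inj h2.
by apply/eqP; rewrite eq_complex h1 h2 !eqxx.
Qed.

End hilbert_real.

Section bop_operations.
Variable R : realType.

Lemma bop_id_subproof (X : hilbertType R) : @idfun X \in bop_pred X X.
Proof. by rewrite inE; split => // x; exact: cvg_id. Qed.

Definition bop_id (X : hilbertType R) : bop X X := Bop (bop_id_subproof X).

Lemma bop_comp_subproof (X Y Z : hilbertType R) (A : bop Y Z) (B : bop X Y) :
  A \o B \in bop_pred X Z.
Proof.
rewrite inE; split=> [a x y|x]; first by rewrite /= !linearP.
by apply: continuous_comp; exact: bop_continuous.
Qed.

Definition bop_comp (X Y Z : hilbertType R) (A : bop Y Z) (B : bop X Y) :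
  bop X Z := Bop (bop_comp_subproof A B).

Lemma adj_ex (X Y : hilbertType R) (A : bop X Y) :
  exists B : bop Y X, forall x y, '[A x, y] = '[x, B y].
Proof.
have [M M0 AM] := bop_bounded A.
have AMc x : `|A x| <= (M%:C)%C * `|x| by rewrite !nrmE -rmorphM/= lecR.
have ex y : exists z, forall x, '[A x, y] = '[x, z].
  have lf : scalar (fun x => '[A x, y]).
    by move=> a x z; rewrite linearP hdotDl hdotZl.
  pose f : {scalar X} := HB.pack (fun x => '[A x, y])
    (GRing.isLinear.Build R[i] X R[i] *%R _ lf).
  apply: (@riesz _ _ f (M * nrm y)); first by rewrite mulr_ge0// nrm_ge0.
  move=> x; apply: (le_trans (hdot_le _ _)).
  by rewrite rmorphM/= -nrmE mulrAC ler_wpM2r.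
have [B BP] := choice ex.
have Bl : linear B.
  move=> a y z; apply: hdot_eqP => x.
  by rewrite -BP !hdotDr !hdotZr !BP.
have Bb y : `|B y| <= (M%:C)%C * `|y|.
  have [->|By0] := eqVneq (B y) 0; first by rewrite normr0 mulr_ge0// ler0c.
  rewrite -(@ler_pM2l _ `|B y|) ?normr_gt0//.
  rewrite -expr2 -hdotE -BP mulrA.
  have := hdot_le (A (B y)) y.
  rewrite ger0_norm; last by rewrite BP hdotE exprn_ge0.
  move/le_trans; apply; rewrite [_ * (M%:C)%C]mulrC ler_wpM2r//.
have Bm := bop_subproof Bl Bb.
by exists (Bop Bm) => x y; rewrite BP.
Qed.

Definition adj (X Y : hilbertType R) (A : bop X Y) : bop Y X :=
  sval (cid (adj_ex A)).

Lemma adjP (X Y : hilbertType R) (A : bop X Y) x y : '[A x, y] = '[x, adj A y].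
Proof. by rewrite /adj; case: cid. Qed.

End bop_operations.

(* The product type of MathComp-Analysis carries the sup norm; [hsum] is the
   same vector space with the Hilbert norm. *)
Definition hsum (R : realType) (X Y : hilbertType R) : Type := (X * Y)%type.

Section direct_sum.
Variables (R : realType) (X Y : hilbertType R).
Implicit Types p q : hsum X Y.

HB.instance Definition _ := GRing.Lmodule.copy (hsum X Y) (X * Y)%type.

Definition hsum_dot p q : R[i] := '[p.1, q.1] + '[p.2, q.2].

Lemma hsum_dot_bilinear :
  bilinear_for *%R (@Num.conj R[i] \; *%R) hsum_dot.
Proof.
split=> [q a p p'|p a q q']; rewrite /hsum_dot /=.
  by rewrite !hdotDl !hdotZl mulrDr addrACA.
by rewrite !hdotDr !hdotZr mulrDr addrACA.
Qed.

HB.instance Definition _ := bilinear_isBilinear.Build R[i]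
  (hsum X Y) (hsum X Y) R[i] *%R (@Num.conj R[i] \; *%R) hsum_dot
  hsum_dot_bilinear.

Lemma hsum_dot_hermitian p q :
  hsum_dot p q = (-1) ^+ false * (hsum_dot q p)^*.
Proof.
by rewrite mul1r /hsum_dot rmorphD /= -!hdot_conj.
Qed.

HB.instance Definition _ := isHermitianSesquilinear.Build R[i]
  (hsum X Y) false (@Num.conj R[i]) hsum_dot hsum_dot_hermitian.

Lemma hsum_dot_gt0 p : p != 0 -> 0 < hsum_dot p p.
Proof.
move=> p0; rewrite lt_def /hsum_dot !hdotE addr_ge0 ?exprn_ge0// andbT.
apply: contra p0; rewrite paddr_eq0 ?exprn_ge0// !sqrf_eq0 !normr_eq0.
by case: p => x y /= /andP[/eqP-> /eqP->].
Qed.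

HB.instance Definition _ := isDotProduct.Build R[i] (hsum X Y) hsum_dot
  hsum_dot_gt0.

Definition hsum_norm p : R[i] := sqrtC (hsum_dot p p).

Lemma hsum_normD p q : hsum_norm (p + q) <= hsum_norm p + hsum_norm q.
Proof. exact: (dot_norm_triangle hsum_dot). Qed.

Lemma hsum_normZ a p : hsum_norm (a *: p) = `|a| * hsum_norm p.
Proof.
rewrite /hsum_norm (dnormZ hsum_dot) sqrtCM ?nnegrE ?exprn_ge0//.
by rewrite sqrCK.
Qed.

Lemma hsum_norm_eq0 p : hsum_norm p = 0 -> p = 0.
Proof. by move/eqP; rewrite sqrtC_eq0 (dnorm_eq0 hsum_dot) => /eqP. Qed.

HB.instance Definition _ := Lmodule_isNormed.Build R[i] (hsum X Y)
  hsum_normD hsum_normZ hsum_norm_eq0.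

Lemma hsum_dotE p : hsum_dot p p = `|p| ^+ 2.
Proof. by rewrite [`|p|]/(hsum_norm p) sqrtCK. Qed.

Lemma hsum_norm_sqr p : `|p| ^+ 2 = `|p.1| ^+ 2 + `|p.2| ^+ 2.
Proof. by rewrite -hsum_dotE /hsum_dot !hdotE. Qed.

Lemma hsum_norm1 p : `|p.1| <= `|p|.
Proof.
by rewrite -ler_sqr ?nnegrE// hsum_norm_sqr lerDl exprn_ge0.
Qed.

Lemma hsum_norm2 p : `|p.2| <= `|p|.
Proof.
by rewrite -ler_sqr ?nnegrE// hsum_norm_sqr lerDr exprn_ge0.
Qed.

Lemma hsum_norm_le p : `|p| <= `|p.1| + `|p.2|.
Proof.
rewrite -ler_sqr ?nnegrE ?addr_ge0// hsum_norm_sqr sqrrD.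
by rewrite addrAC lerDl mulrn_wge0// mulr_ge0.
Qed.

Lemma hsum_complete (F : set_system (hsum X Y)) :
  ProperFilter F -> cauchy F -> cvg F.
Proof.
move=> FF /cauchy_ballP cF.
have c1 : cauchy ((fun p : hsum X Y => p.1) @ F).
  apply/cauchy_ballP => e e0; have [[A B] [/= FA FB] AB] := cF e e0.
  exists ((fun p : hsum X Y => p.1) @` A, (fun p : hsum X Y => p.1) @` B).
    by split=> /=; [apply: filterS FA|apply: filterS FB] => p ?; exists p.
  move=> _ /= [[p Ap <-] [q Bq <-]].
  have := AB (p, q) (conj Ap Bq); rewrite /= -!ball_normE/=.
  by apply: le_lt_trans; exact: (hsum_norm1 (p - q)).
have c2 : cauchy ((fun p : hsum X Y => p.2) @ F).
  apply/cauchy_ballP => e e0; have [[A B] [/= FA FB] AB] := cF e e0.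
  exists ((fun p : hsum X Y => p.2) @` A, (fun p : hsum X Y => p.2) @` B).
    by split=> /=; [apply: filterS FA|apply: filterS FB] => p ?; exists p.
  move=> _ /= [[p Ap <-] [q Bq <-]].
  have := AB (p, q) (conj Ap Bq); rewrite /= -!ball_normE/=.
  by apply: le_lt_trans; exact: (hsum_norm2 (p - q)).
have [x d1] : exists x : X, p.1 @[p --> F] --> x.
  by exists (lim ((fun p : hsum X Y => p.1) @ F)); exact: cauchy_cvg.
have [y d2] : exists y : Y, p.2 @[p --> F] --> y.
  by exists (lim ((fun p : hsum X Y => p.2) @ F)); exact: cauchy_cvg.
apply/cvg_ex; exists ((x, y) : hsum X Y).
apply/(@fcvgrPdist_lt _ _ F (@filter_filter _ _ FF)) => e e0.
have e20 : 0 < e / 2 by rewrite divr_gt0.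
have h1 := (@cvgrPdist_lt _ _ _ F (@filter_filter _ _ FF) _ _).1 d1 _ e20.
have h2 := (@cvgrPdist_lt _ _ _ F (@filter_filter _ _ FF) _ _).1 d2 _ e20.
near=> p.
apply: (le_lt_trans (hsum_norm_le _)); rewrite (splitr e) ltrD//=.
  by near: p; exact: h1.
by near: p; exact: h2.
Unshelve. all: by end_near. Qed.

HB.instance Definition _ := Uniform_isComplete.Build (hsum X Y) hsum_complete.

HB.instance Definition _ := CompleteNormedModule_isHilbert.Build R (hsum X Y)
  hsum_dotE.

Lemma hdot_hsumE p q : '[p, q] = '[p.1, q.1] + '[p.2, q.2].
Proof. by []. Qed.

End direct_sum.

Section block_operators.
Variables (R : realType) (X Y : hilbertType R).

Let fst_fun (p : hsum X Y) := p.1.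
Let snd_fun (p : hsum X Y) := p.2.
Let inl_fun (x : X) : hsum X Y := (x, 0).
Let inr_fun (y : Y) : hsum X Y := (0, y).

Lemma hfst_subproof : fst_fun \in bop_pred (hsum X Y) X.
Proof. by apply: (@bop_subproof _ _ _ _ 1) => // p; rewrite mul1r hsum_norm1. Qed.

Lemma hsnd_subproof : snd_fun \in bop_pred (hsum X Y) Y.
Proof. by apply: (@bop_subproof _ _ _ _ 1) => // p; rewrite mul1r hsum_norm2. Qed.

Lemma hinl_subproof : inl_fun \in bop_pred X (hsum X Y).
Proof.
apply: (@bop_subproof _ _ _ _ 1) => [a x y|x].
  by congr pair => /=; rewrite scaler0 addr0.
by rewrite mul1r (le_trans (hsum_norm_le _))//= normr0 addr0.
Qed.

Lemma hinr_subproof : inr_fun \in bop_pred Y (hsum X Y).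
Proof.
apply: (@bop_subproof _ _ _ _ 1) => [a x y|x].
  by congr pair => /=; rewrite scaler0 addr0.
by rewrite mul1r (le_trans (hsum_norm_le _))//= normr0 add0r.
Qed.

Definition hfst : bop (hsum X Y) X := Bop hfst_subproof.
Definition hsnd : bop (hsum X Y) Y := Bop hsnd_subproof.
Definition hinl : bop X (hsum X Y) := Bop hinl_subproof.
Definition hinr : bop Y (hsum X Y) := Bop hinr_subproof.

End block_operators.
Arguments hfst {R X Y}.
Arguments hsnd {R X Y}.
Arguments hinl {R X Y}.
Arguments hinr {R X Y}.

Declare Scope bop_scope.
Delimit Scope bop_scope with B.
Notation "A ∘ B" := (bop_comp A B) (at level 40, left associativity) : bop_scope.
Local Open Scope bop_scope.

(* Rows (K, M) and (L, N). *)
Definition block (R : realType) (X Y : hilbertType R)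
    (K : bop X X) (M : bop Y X) (L : bop X Y) (N : bop Y Y) :
    bop (hsum X Y) (hsum X Y) :=
  hinl ∘ K ∘ hfst + hinl ∘ M ∘ hsnd + hinr ∘ L ∘ hfst
    + hinr ∘ N ∘ hsnd.

Section blocks.
Variables (R : realType) (X Y : hilbertType R) (F : bop (hsum X Y) (hsum X Y)).

Definition blockK : bop X X := hfst ∘ F ∘ hinl.
Definition blockM : bop Y X := hfst ∘ F ∘ hinr.
Definition blockL : bop X Y := hsnd ∘ F ∘ hinl.
Definition blockN : bop Y Y := hsnd ∘ F ∘ hinr.

End blocks.

Record csub (R : realType) (V : hilbertType R) := CSub {
  csub_set :> set V ;
  csub0 : csub_set 0 ;
  csubP : forall a x y, csub_set x -> csub_set y -> csub_set (a *: x + y) ;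
  csub_closed : closed csub_set
}.

Section subspaces.
Variables (R : realType) (V : hilbertType R).
Implicit Types W : csub V.

Lemma csub_eqP W W' : W = W' <-> (W = W' :> set V).
Proof.
split=> [->//|]; case: W W' => [S S0 SP Sc] [T T0 TP Tc] /= ST.
by case: T / ST T0 TP Tc => T0 TP Tc; congr CSub; exact: Prop_irrelevance.
Qed.

Definition csub_pred W : {pred V} := mem (csub_set W).

Record csub_type W := CSubType { cval : V ; cval_mem : cval \in csub_pred W }.

Variable W : csub V.
Local Notation S := (csub_type W).

HB.instance Definition _ := [isSub for @cval W].
HB.instance Definition _ := [Choice of S by <:].

Lemma csub_submod_closed : submod_closed (csub_pred W).
Proof.
split; first by rewrite inE; exact: csub0.
by move=> a x y; rewrite !inE; exact: csubP.
Qed.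

HB.instance Definition _ :=
  GRing.isSubmodClosed.Build _ _ (csub_pred W) csub_submod_closed.
HB.instance Definition _ := [SubChoice_isSubLmodule of S by <:].

Lemma cvalP (x : S) : csub_set W (cval x).
Proof. by have := cval_mem x; rewrite inE. Qed.

Lemma cvalD (x y : S) : cval (x + y) = cval x + cval y.
Proof. exact: (raddfD (val : S -> V)). Qed.

Lemma cvalB (x y : S) : cval (x - y) = cval x - cval y.
Proof. exact: (raddfB (val : S -> V)). Qed.

Lemma cvalZ a (x : S) : cval (a *: x) = a *: cval x.
Proof. exact: (linearZ_LR (val : S -> V)). Qed.

Definition csub_dot (x y : S) : R[i] := '[cval x, cval y].

Lemma csub_dot_bilinear :
  bilinear_for *%R (@Num.conj R[i] \; *%R) csub_dot.
Proof.
split=> [z a x y|x a y z]; rewrite /csub_dot /=.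
  by rewrite !hdotDl !hdotZl.
by rewrite !hdotDr !hdotZr.
Qed.

HB.instance Definition _ := bilinear_isBilinear.Build R[i]
  S S R[i] *%R (@Num.conj R[i] \; *%R) csub_dot csub_dot_bilinear.

Lemma csub_dot_hermitian x y :
  csub_dot x y = (-1) ^+ false * (csub_dot y x)^*.
Proof. by rewrite mul1r -hdot_conj. Qed.

HB.instance Definition _ := isHermitianSesquilinear.Build R[i]
  S false (@Num.conj R[i]) csub_dot csub_dot_hermitian.

Lemma csub_dot_gt0 x : x != 0 -> 0 < csub_dot x x.
Proof.
move=> x0; rewrite lt_def /csub_dot hdotE exprn_ge0// andbT.
rewrite sqrf_eq0 normr_eq0; apply: contra x0 => /eqP x0.
by apply/eqP/val_inj.
Qed.

HB.instance Definition _ := isDotProduct.Build R[i] S csub_dot csub_dot_gt0.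

Definition csub_norm (x : S) : R[i] := `|cval x|.

Lemma csub_normD x y : csub_norm (x + y) <= csub_norm x + csub_norm y.
Proof. by rewrite /csub_norm cvalD ler_normD. Qed.

Lemma csub_normZ a x : csub_norm (a *: x) = `|a| * csub_norm x.
Proof. by rewrite /csub_norm cvalZ normrZ. Qed.

Lemma csub_norm_eq0 x : csub_norm x = 0 -> x = 0.
Proof. by move/normr0_eq0 => x0; apply/val_inj. Qed.

HB.instance Definition _ := Lmodule_isNormed.Build R[i] S
  csub_normD csub_normZ csub_norm_eq0.

Lemma csub_normE (x : S) : `|x| = `|cval x|. Proof. by []. Qed.

Lemma csub_complete (F : set_system S) : ProperFilter F -> cauchy F -> cvg F.
Proof.
move=> FF /cauchy_ballP cF.
have c1 : cauchy (@cval W @ F).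
  apply/cauchy_ballP => e e0; have [[A B] [/= FA FB] AB] := cF e e0.
  exists (@cval W @` A, @cval W @` B).
    by split=> /=; [apply: filterS FA|apply: filterS FB] => p ?; exists p.
  move=> _ /= [[p Ap <-] [q Bq <-]].
  have := AB (p, q) (conj Ap Bq); rewrite /= -!ball_normE/=.
  by rewrite csub_normE cvalB.
have [x d1] : exists x : V, cval p @[p --> F] --> x.
  by exists (lim (@cval W @ F)); exact: cauchy_cvg.
have Wx : csub_set W x.
  apply: (@closed_cvg _ _ F _ (@cval W) (csub_set W) (@csub_closed _ _ W)) d1.
  by apply: nearW => p; exact: cvalP.
apply/cvg_ex; exists (CSubType (mem_set Wx)).
apply/(@fcvgrPdist_lt _ _ F (@filter_filter _ _ FF)) => e e0.
have h1 := (@cvgrPdist_lt _ _ _ F (@filter_filter _ _ FF) _ _).1 d1 _ e0.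
by apply: filterS h1 => p; rewrite csub_normE cvalB.
Qed.

HB.instance Definition _ := Uniform_isComplete.Build S csub_complete.

Lemma csub_dotE x : csub_dot x x = `|x| ^+ 2.
Proof. by rewrite /csub_dot hdotE csub_normE. Qed.

HB.instance Definition _ :=
  CompleteNormedModule_isHilbert.Build R S csub_dotE.

Lemma hdot_csubE (x y : S) : '[x, y] = '[cval x, cval y].
Proof. by []. Qed.

Lemma cincl_subproof : @cval W \in bop_pred S V.
Proof.
apply: (@bop_subproof _ _ _ _ 1) => [a x y|x].
  by rewrite cvalD cvalZ.
by rewrite mul1r csub_normE.
Qed.

Definition cincl : bop S V := Bop cincl_subproof.

End subspaces.

Section closed_span.
Variables (R : realType) (V : hilbertType R).
Implicit Types A S : set V.

Definition lin_span S : set V := [set x | exists n (c : 'I_n -> R[i]) (v : 'I_n -> V),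
  (forall i, S (v i)) /\ x = \sum_(i < n) c i *: v i].

Lemma closure_normP A x :
  closure A x <-> forall e, 0 < e -> exists2 y, A y & `|x - y| < e.
Proof.
split=> [cx e e0|Ax B /nbhs_normP[e e0 eB]].
  have /cx[y [Ay]] : nbhs x (ball x e) by apply: nbhsx_ballx.
  by rewrite -ball_normE/= => xy; exists y.
by have [y Ay xy] := Ax e e0; exists y; split=> //; exact: eB.
Qed.

Lemma lin_span0 S : lin_span S 0.
Proof.
by exists 0%N, (fun=> 0), (fun=> 0); split=> [[]//|]; rewrite big_ord0.
Qed.

Lemma lin_spanP S a x y :
  lin_span S x -> lin_span S y -> lin_span S (a *: x + y).
Proof.
move=> [m [c [v [Sv ->]]]] [n [d [w [Sw ->]]]].
pose c' (i : 'I_(m + n)) := match fintype.split i with inl j => a * c j | inr j => d j end.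
pose v' (i : 'I_(m + n)) := match fintype.split i with inl j => v j | inr j => w j end.
exists (m + n)%N, c', v'; split=> [i|].
  by rewrite /v'; case: fintype.split.
rewrite big_split_ord /= scaler_sumr; congr (_ + _); apply: eq_bigr => i _.
  by rewrite scalerA /c' /v'; case: split_ordP => j /eqP;
    rewrite ?eq_lshift ?eq_lrshift// => /eqP->.
by rewrite /c' /v'; case: split_ordP => j /eqP;
  rewrite ?eq_rshift ?eq_rlshift// => /eqP->.
Qed.

Lemma closure_span0 S : closure (lin_span S) 0.
Proof. by apply: subset_closure; exact: lin_span0. Qed.

Lemma closure_spanP S a x y : closure (lin_span S) x ->
  closure (lin_span S) y -> closure (lin_span S) (a *: x + y).
Proof.
move=> /closure_normP cx /closure_normP cy; apply/closure_normP => e e0.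
have a1 : 0 < `|a| + 1 by rewrite ltr_wpDl.
have [|x' Sx' xx'] := cx (e / 2 / (`|a| + 1)); first by rewrite !divr_gt0.
have [|y' Sy' yy'] := cy (e / 2); first by rewrite divr_gt0.
exists (a *: x' + y'); first exact: lin_spanP.
have -> : a *: x + y - (a *: x' + y') = a *: (x - x') + (y - y').
  by rewrite scalerBr opprD addrACA.
apply: (le_lt_trans (ler_normD _ _)); rewrite (splitr e) ler_ltD//.
rewrite normrZ; apply: (@le_trans _ _ ((`|a| + 1) * `|x - x'|)).
  by rewrite ler_wpM2r// lerDl.
by rewrite mulrC -ler_pdivlMr// ltW.
Qed.

Definition cspan S : csub V :=
  CSub (closure_span0 S) (@closure_spanP S) (@closed_closure V (lin_span S)).

Lemma sub_cspan S : S `<=` csub_set (cspan S).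
Proof.
move=> x Sx; apply: subset_closure; exists 1%N, (fun=> 1), (fun=> x).
by split=> //; rewrite big_ord1 scale1r.
Qed.

End closed_span.

(* A realization of the Hilbert space tensor product of [k] and [h]: a Hilbert
   space with a bilinear map satisfying
   '[x ⊗ u, y ⊗ v] = '[x, y] * '[u, v] and having total range. These properties
   characterize it up to a unique unitary commuting with the bilinear maps. *)
Record htensor (R : realType) (k h : hilbertType R) := HTensor {
  htensor_space :> hilbertType R ;
  tens : {bilinear k -> h -> htensor_space} ;
  tens_dot : forall x u y v, '[tens x u, tens y v] = '[x, y] * '[u, v] ;
  tens_total :
    closure (lin_span [set tens x u | x in [set: k] & u in [set: h]]) = setT
}.
Arguments tens {R k h T} : rename.

Section subtensor.
Variables (R : realType) (k h : hilbertType R) (T : htensor k h) (W : csub k).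

(* W ⊗ h, identified with a closed subspace of k ⊗ h *)
Definition subtens_csub : csub T :=
  cspan [set tens x u | x in csub_set W & u in [set: h]].

Lemma subtens_subproof (x : csub_type W) (u : h) :
  tens (cval x) u \in csub_pred subtens_csub.
Proof.
apply/mem_set/sub_cspan.
by exists (cval x); [exact: cvalP|exists u].
Qed.

Definition subtens (x : csub_type W) (u : h) : csub_type subtens_csub :=
  CSubType (subtens_subproof x u).

Lemma subtens_bilinear : bilinear_for *:%R *:%R subtens.
Proof.
by split=> [u a x y|x a u v]; apply/val_inj;
  rewrite /= ?linearPl ?linearPr.
Qed.

HB.instance Definition _ := bilinear_isBilinear.Build R[i]
  (csub_type W) h (csub_type subtens_csub) *:%R *:%R subtens subtens_bilinear.

Lemma subtens_dot x u y v :
  '[subtens x u, subtens y v] = '[x, y] * '[u, v].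
Proof. by rewrite !hdot_csubE tens_dot. Qed.

Lemma subtens_total :
  closure (lin_span [set subtens x u | x in [set: csub_type W] & u in [set: h]])
  = setT.
Proof.
apply/seteqP; split=> // z _; apply/closure_normP => e e0.
have /closure_normP/(_ e e0)[_ [n [c [v [vP ->]]]] ze] := cvalP z.
have {}vP i : exists w : csub_type subtens_csub,
    [set subtens x u | x in [set: csub_type W] & u in [set: h]] w /\ v i = cval w.
  have [x Wx [u _ <-]] := vP i.
  exists (subtens (CSubType (mem_set Wx)) u); split=> //.
  by exists (CSubType (mem_set Wx)) => //; exists u.
have [w wP] := choice vP.
exists (\sum_(i < n) c i *: w i).
  by exists n, c, w; split=> // i; have [] := wP i.
rewrite csub_normE cvalB; move: ze; congr (`|_ - _| < e).
transitivity (cincl subtens_csub (\sum_(i < n) c i *: w i)); last by [].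
rewrite linear_sum; apply: eq_bigr => i _.
by rewrite linearZ (wP i).2.
Qed.

Definition subtensor : htensor (csub_type W) h :=
  HTensor subtens_dot subtens_total.

End subtensor.

Section generators.
Variables (R : realType) (k h : hilbertType R) (T : htensor k h).

(* (C ⊕ k) ⊗ h, as h ⊕ (k ⊗ h) *)
Definition hat : hilbertType R := hsum h T.

Definition bop_le (X : hilbertType R) (A B : bop X X) : Prop :=
  forall x, 0 <= '[(B - A) x, x].

Definition Delta : bop hat hat := hinr ∘ hsnd.

Definition DeltaC : bop hat hat := bop_id hat - Delta.

Definition lhd (F1 F2 : bop hat hat) : bop hat hat :=
  F1 + F1 ∘ Delta ∘ F2 + F2.

Definition cgen : set (bop hat hat) := [set F | bop_le (lhd (adj F) F) 0].

Definition qcgen : set (bop hat hat) :=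
  [set F + (b%:C)%C *: DeltaC | F in cgen & b in [set b : R | 0 <= b]].

Lemma rtens_subproof (u : h) : tens (T := T) ^~ u \in bop_pred k T.
Proof.
apply: (@bop_subproof _ _ _ _ (nrm u)) => [a x y|x]; first exact: linearPl.
rewrite -nrmE -ler_sqr ?nnegrE ?mulr_ge0//.
by rewrite exprMn -!hdotE tens_dot mulrC.
Qed.

(* I ⊗ |u⟩ and its adjoint I ⊗ ⟨u| *)
Definition tens_ket (u : h) : bop k T := Bop (rtens_subproof u).

Definition tens_bra (u : h) : bop T k := adj (tens_ket u).

(* k_p^C; the range of (C - I)^* is not closed in general. *)
Definition kp (C : bop T T) : csub k :=
  cspan [set tens_bra u xi | xi in range (adj (C - bop_id T)) & u in [set: h]].

(* The lower right block of F is C - I, so C = blockN F + I. *)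
Definition wholly_nonGaussian (F : bop hat hat) : Prop :=
  qcgen F /\ csub_set (kp (blockN F + bop_id T)) = [set: k].

Definition pure_Gaussian (F : bop hat hat) : Prop :=
  qcgen F /\ exists L : bop h T,
    F = block (- 2^-1 *: (adj L ∘ L)) (- adj L) L 0.

End generators.

Record odecomp (R : realType) (k : hilbertType R) := ODecomp {
  odec1 : csub k ;
  odec2 : csub k ;
  odec_orth : forall x y, csub_set odec1 x -> csub_set odec2 y -> '[x, y] = 0 ;
  odec_sum : forall z, exists2 x, csub_set odec1 x &
    exists2 y, csub_set odec2 y & z = x + y
}.

Section concatenation.
Variables (R : realType) (k h : hilbertType R) (T : htensor k h).
Variable D : odecomp k.

Local Notation T1 := (subtensor T (odec1 D)).
Local Notation T2 := (subtensor T (odec2 D)).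

(* The inclusions J1, J2 of k1 ⊗ h, k2 ⊗ h implement the identification of
   (k1 ⊗ h) ⊕ (k2 ⊗ h) with k ⊗ h; their adjoints are the projections. *)
Definition boxplus (F1 : bop (hat T1) (hat T1)) (F2 : bop (hat T2) (hat T2)) :
    bop (hat T) (hat T) :=
  let J1 : bop T1 T := cincl (subtens_csub T (odec1 D)) in
  let J2 : bop T2 T := cincl (subtens_csub T (odec2 D)) in
  block (blockK F1 + blockK F2)
        (blockM F1 ∘ adj J1 + blockM F2 ∘ adj J2)
        (J1 ∘ blockL F1 + J2 ∘ blockL F2)
        (J1 ∘ blockN F1 ∘ adj J1 + J2 ∘ blockN F2 ∘ adj J2).

End concatenation.

Record concat_data (R : realType) (k h : hilbertType R) (T : htensor k h) :=
  ConcatData {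
    cd_dec : odecomp k ;
    cd_fst : bop (hat (subtensor T (odec1 cd_dec)))
                 (hat (subtensor T (odec1 cd_dec))) ;
    cd_snd : bop (hat (subtensor T (odec2 cd_dec)))
                 (hat (subtensor T (odec2 cd_dec)))
  }.

(* Main.v *)
Require Import Defs.
From mathcomp Require Import all_boot all_order all_algebra.
From mathcomp Require Import complex.
From mathcomp Require Import all_classical all_reals.
From mathcomp Require Import topology normedtype.
From mathcomp Require Import ring lra.

Set Implicit Arguments.
Unset Strict Implicit.
Unset Printing Implicit Defensive.

Import Order.TTheory GRing.Theory Num.Theory.
Import numFieldNormedType.Exports.

Local Open Scope classical_set_scope.
Local Open Scope ring_scope.
Local Open Scope bop_scope.

(** Write N = C - I for the lower right block of F. A vector y of k is orthogonal
    to the closed span k_p^C exactly when N (y ⊗ u) = 0 for all u ([orth_kp]),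
    because k_p^C is spanned by the slices of the range of N^*.

    The whole analytic content is a rigidity property of the vectors that N
    kills. For F in qc there is b with
      2 Re <F x, x> + |Δ F x|^2 <= 2 b |Δ^⊥ x|^2   for all x   ([qcgenP]),
    and if N eta = 0 then along the line x + t (0, eta) the left-hand side is
    affine in the real number t while the right-hand side is constant. Its slope
    therefore vanishes, which for all x together means
    F (0, eta) = - F^* (0, eta) ([gaussian_direction]), that is N^* eta = 0 and
    M eta = - L^* eta ([gaussian_blocks]).

    Existence. Take k1 = k_p^C and k2 its orthogonal complement. Then N vanishes
    on k2 ⊗ h, hence so does N^*, so N lives on k1 ⊗ h; and M = - L^* on k2 ⊗ h.
    With L_i, M_i the compressions of L, M to k_i ⊗ h and N_1 that of N, the
    operator F is the concatenation of
      [K + L_2^* L_2 / 2, M_1; L_1, N_1]  and  [- L_2^* L_2 / 2, - L_2^*; L_2, 0].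
    The form above, evaluated for the first of these at (u, eta), equals the form
    of F at (u, eta), since the term |L_2 u|^2 lost by compressing L is put back
    by the correction of K; so the first component is in qc. It is wholly
    non-Gaussian because a vector of k1 orthogonal to its k_p is also orthogonal
    to k_p^C = k1.

    Uniqueness. In any decomposition the lower right block of F is N_1 ⊕ 0.
    It kills k2 ⊗ h, and as the first component is wholly non-Gaussian it kills
    x ⊗ h for no other x; so k2 is the complement of k_p^C ([boxplus_kp]). Once
    the decomposition of k is known, L_2 is a compression of L and determines the
    pure Gaussian component, and the remaining blocks are compressions of F
    ([boxplus_parts]). *)

(** * Operators evaluated at vectors *)

Section bop_pointwise.
Variables (R : realType) (X Y Z : hilbertType R).

Lemma bopDE (A B : bop X Y) x : (A + B) x = A x + B x. Proof. by []. Qed.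
Lemma bopNE (A : bop X Y) x : (- A) x = - A x. Proof. by []. Qed.
Lemma bopZE a (A : bop X Y) x : (a *: A) x = a *: A x. Proof. by []. Qed.
Lemma bop0E x : (0 : bop X Y) x = 0. Proof. by []. Qed.
Lemma bop_compE (A : bop Y Z) (B : bop X Y) x : (A ∘ B) x = A (B x).
Proof. by []. Qed.
Lemma bop0 (A : bop X Y) : A 0 = 0. Proof. exact: linear0. Qed.
Lemma bop_add (A : bop X Y) x y : A (x + y) = A x + A y.
Proof. exact: linearD. Qed.
Lemma bop_sub (A : bop X Y) x y : A (x - y) = A x - A y.
Proof. exact: linearB. Qed.
Lemma bop_scale (A : bop X Y) a x : A (a *: x) = a *: A x.
Proof. exact: linearZ. Qed.

End bop_pointwise.

(** * Orthogonality and closed subspaces *)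

Section orthogonality.
Variables (R : realType) (V : hilbertType R).
Implicit Types (x y z : V) (W : csub V) (S : set V).

Definition orth S : set V := [set y | forall x, S x -> '[x, y] = 0].

Lemma hdotNl x y : '[- x, y] = - '[x, y]. Proof. exact: linearNl. Qed.

Lemma hdot_eq0C x y : '[x, y] = 0 -> '[y, x] = 0.
Proof. by move=> xy; rewrite hdot_conj xy conjC0. Qed.

Lemma Re_hdot_eq0 x : complex.Re '[x, x] = 0 -> x = 0.
Proof.
move=> x0; apply/eqP; rewrite -normr_eq0 -sqrf_eq0 -hdotE -nrm_sqr.
by rewrite nrm_sqrE x0.
Qed.

Lemma hdot_eq0 x : '[x, x] = 0 -> x = 0.
Proof. by move=> x0; apply: Re_hdot_eq0; rewrite x0. Qed.

Lemma orth0 S : orth S 0.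
Proof. by move=> x _; rewrite hdot0r. Qed.

Lemma orthP S a x y : orth S x -> orth S y -> orth S (a *: x + y).
Proof. by move=> Sx Sy z Sz; rewrite hdotDr hdotZr Sx// Sy// mulr0 addr0. Qed.

Lemma orth_closed S : closed (orth S).
Proof.
move=> y /closure_normP cy x Sx; apply/eqP; rewrite -normr_eq0.
apply/eqP/le_anti; rewrite normr_ge0 andbT; apply/ler_addgt0Pr => e e0.
have x1 : 0 < `|x| + 1 by rewrite ltr_wpDl.
have [|z Sz yz] := cy (e / (`|x| + 1)); first by rewrite divr_gt0.
rewrite add0r -[y](subrK z) hdotDr (Sz _ Sx) addr0.
apply: (le_trans (hdot_le _ _)).
rewrite -[leRHS](divfK (lt0r_neq0 x1)) mulrC ler_pM//; first exact: ltW.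
by rewrite lerDl.
Qed.

Definition orth_csub S : csub V :=
  CSub (@orth0 S) (@orthP S) (@orth_closed S).

Lemma cspan_min S W : S `<=` W -> cspan S `<=` W.
Proof.
move=> SW; suff : lin_span S `<=` W.
  by move=> /closure_subset; rewrite -(closure_id W).1//; exact: csub_closed.
move=> _ [n [c [v [vS ->]]]].
elim/big_ind: _ => [|y z Wy Wz|i _]; first exact: csub0.
  by rewrite -[y]scale1r; exact: csubP.
by rewrite -[_ *: _]addr0; apply: csubP; [exact/SW/vS|exact: csub0].
Qed.

Lemma orth_cspan S : orth (cspan S) = orth S.
Proof.
apply/seteqP; split=> y Sy x; first by move=> /sub_cspan; exact: Sy.
have /cspan_min : S `<=` orth_csub [set y].
  by move=> z Sz w ->; apply: hdot_eq0C; exact: Sy.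
by move=> h /h/(_ y)/(_ erefl)/hdot_eq0C.
Qed.

Lemma cincl_adjK W : cancel (cincl W) (adj (cincl W)).
Proof. by move=> x; apply: hdot_eqP => z; rewrite -adjP. Qed.

Lemma orth_proj W x : orth W (x - cincl W (adj (cincl W) x)).
Proof.
move=> y Wy; have -> : y = cincl W (CSubType (mem_set Wy)) by [].
by rewrite adjP bop_sub cincl_adjK subrr hdot0r.
Qed.

(** The adjoint of the isometric inclusion of W is the orthogonal projection onto
    W. So the bipolar theorem follows from the existence of adjoints. Comparing
    closed subspaces through their orthogonal complements avoids all closures in
    what follows. *)
Lemma csub_orthP W x : (forall y, orth W y -> '[x, y] = 0) -> csub_set W x.
Proof.
move=> xW; pose p := adj (cincl W) x.
suff -> : x = cincl W p by exact: cvalP.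
apply/eqP; rewrite -subr_eq0; apply/eqP/hdot_eq0.
rewrite hdotBl xW ?sub0r; last exact: orth_proj.
by rewrite (orth_proj x (cvalP p)) oppr0.
Qed.

Lemma csub_orth_inj W W' : orth W = orth W' -> W = W'.
Proof.
move=> e; apply/csub_eqP/seteqP; split=> x Wx; apply: csub_orthP => y.
  by rewrite -e; exact.
by rewrite e; exact.
Qed.

Lemma csub_setTP W : W = [set: V] :> set V <-> orth W `<=` [set 0].
Proof.
split=> [WT y Wy|W0]; first by apply: hdot_eq0; apply: Wy; rewrite WT.
apply/seteqP; split=> // x _; apply: csub_orthP => y /W0 ->.
exact: hdot0r.
Qed.

Lemma orthogonal_decomposition W z :
  exists2 x, csub_set W x & exists2 y, orth W y & z = x + y.
Proof.
exists (cincl W (adj (cincl W) z)); first exact: cvalP.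
by exists (z - cincl W (adj (cincl W) z)); [exact: orth_proj|rewrite addrC subrK].
Qed.

End orthogonality.

Lemma adjPr (R : realType) (X Y : hilbertType R) (A : bop X Y) x y :
  '[adj A y, x] = '[y, A x].
Proof. by rewrite hdot_conj -adjP -hdot_conj. Qed.

Section block_matrices.
Variables (R : realType) (X Y : hilbertType R).
Implicit Types (K : bop X X) (M : bop Y X) (L : bop X Y) (N : bop Y Y).

Lemma blockE K M L N (p : hsum X Y) :
  block K M L N p = (K p.1 + M p.2, L p.1 + N p.2) :> hsum X Y.
Proof. by congr pair => /=; rewrite ?addr0 ?add0r. Qed.

Lemma block1E K M L N (p : hsum X Y) : (block K M L N p).1 = K p.1 + M p.2.
Proof. by rewrite blockE. Qed.

Lemma block2E K M L N (p : hsum X Y) : (block K M L N p).2 = L p.1 + N p.2.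
Proof. by rewrite blockE. Qed.

Lemma block_eta (F : bop (hsum X Y) (hsum X Y)) :
  F = block (blockK F) (blockM F) (blockL F) (blockN F).
Proof.
apply/bopP => -[x y]; rewrite blockE /=.
have -> : ((x, y) : hsum X Y) = (hinl x : hsum X Y) + (hinr y : hsum X Y).
  by congr pair => /=; rewrite ?addr0 ?add0r.
by rewrite bop_add; case: (F _) => a b; case: (F _).
Qed.

Lemma block_congr K M L N K' M' L' N' :
  K = K' -> M = M' -> L = L' -> N = N' -> block K M L N = block K' M' L' N'.
Proof. by move=> -> -> -> ->. Qed.

Lemma blockKE K M L N : blockK (block K M L N) = K.
Proof. by apply/bopP => x; rewrite /blockK !bop_compE blockE /= bop0 addr0. Qed.

Lemma blockME K M L N : blockM (block K M L N) = M.
Proof. by apply/bopP => x; rewrite /blockM !bop_compE blockE /= bop0 add0r. Qed.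

Lemma blockLE K M L N : blockL (block K M L N) = L.
Proof. by apply/bopP => x; rewrite /blockL !bop_compE blockE /= bop0 addr0. Qed.

Lemma blockNE K M L N : blockN (block K M L N) = N.
Proof. by apply/bopP => x; rewrite /blockN !bop_compE blockE /= bop0 add0r. Qed.

End block_matrices.

(** * Generators and their Gaussian directions *)

Section generators.
Variables (R : realType) (k h : hilbertType R) (T : htensor k h).
Implicit Types (F : bop (hat T) (hat T)) (x y : hat T).

Lemma real_affine_le (a c : R) : (forall t : R, t * a <= c) -> a = 0.
Proof.
move=> ac; apply/eqP; apply: contraT => a0.
by have := ac ((c + 1) / a); rewrite divfK// gerDl ler10.
Qed.

(** The quadratic form of F^* ◁ F, written with the real part of <F x, x> so that
    it is real-valued by construction. *)
Definition dissip F x : R := 2 * complex.Re '[F x, x] + nrm (F x).2 ^+ 2.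

Lemma hdot_lhd F x :
  '[lhd (adj F) F x, x] = ((dissip F x)%:C)%C.
Proof.
rewrite /lhd /dissip !bopDE !bop_compE !hdotDl !adjPr.
rewrite (hdot_conj x) [X in _ + X + _](_ : _ = ((nrm (F x).2 ^+ 2)%:C)%C); last first.
  by rewrite nrm_sqr hdot_hsumE /= hdot0l add0r.
by case: '[F x, x] => a b; apply/eqP; rewrite eq_complex /=; apply/andP; split; apply/eqP; ring.
Qed.

Lemma DeltaCE x : DeltaC T x = (x.1, 0) :> hat T.
Proof.
case: x => u e; rewrite /DeltaC /Delta bopDE bopNE /=.
by congr pair => /=; rewrite ?subr0 ?subrr.
Qed.

Lemma cgenP F : cgen F <-> forall x, dissip F x <= 0.
Proof.
split=> hF x; have := hF x; rewrite bopDE bopNE bop0E sub0r hdotNl hdot_lhd;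
by rewrite oppr_ge0 lecR.
Qed.

Lemma qcgenP F : qcgen F <->
  exists2 b : R, 0 <= b & forall x, dissip F x <= 2 * b * nrm x.1 ^+ 2.
Proof.
have shift G b x : dissip (G - (b%:C)%C *: DeltaC T) x =
    dissip G x - 2 * b * nrm x.1 ^+ 2.
  rewrite /dissip bopDE bopNE bopZE DeltaCE hdotBl hdotZl raddfB /= ReM_real.
  rewrite (_ : '[(x.1, 0) : hat T, x] = '[x.1, x.1]); last first.
    by rewrite hdot_hsumE /= hdot0l addr0.
  rewrite -nrm_sqrE scaler0 subr0; ring.
split=> [[F0 /cgenP F0c [b b0 <-]]|[b b0 Fb]].
  by exists b => // x; rewrite -subr_le0 -shift addrK; exact: F0c.
exists (F - (b%:C)%C *: DeltaC T); first by apply/cgenP => x; rewrite shift subr_le0.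
by exists b => //; rewrite subrK.
Qed.

(** The term |Δ F x|^2 does not change along x + t (0, eta), since Δ F (0, eta) is
    (0, N eta) = 0, and neither does the bound 2 b |x.1|^2: the
    inequality on the whole line forces the remaining, linear term to vanish. *)
Lemma gaussian_direction F eta : qcgen F -> blockN F eta = 0 ->
  F (hinr eta) = - adj F (hinr eta).
Proof.
move=> /qcgenP[b b0 Fb] Neta; pose e : hat T := hinr eta.
have Fe : F e = ((F e).1, 0) by rewrite -Neta; exact: surjective_pairing.
(* The quadratic term t^2 <F e, e> vanishes because F e has no second component. *)
have aff x (t : R) : dissip F (x + (t%:C)%C *: e) =
    dissip F x + t * (2 * complex.Re '[F e + adj F e, x]).
  have FeE : '[F e, e] = 0 by rewrite Fe hdot_hsumE /= hdot0l hdot0r addr0.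
  rewrite /dissip bop_add bop_scale.
  have -> : (F x + (t%:C)%C *: F e).2 = (F x).2.
    by rewrite Fe /= scaler0 addr0.
  have -> : '[F x + (t%:C)%C *: F e, x + (t%:C)%C *: e] =
      '[F x, x] + (t%:C)%C * ('[F e, x] + ('[adj F e, x])^*).
    rewrite [LHS]hdotDl ![in LHS]hdotDr !hdotZl !hdotZr FeE !mulr0 addr0.
    rewrite conj_Creal ?complex_real// [in RHS]adjPr -hdot_conj; ring.
  rewrite [in RHS]hdotDl.
  by move: '[F x, x] '[F e, x] '[adj F e, x] => [a a'] [c c'] [d d'] /=; ring.
have zero x : complex.Re '[F e + adj F e, x] = 0.
  suff : 2 * complex.Re '[F e + adj F e, x] = 0 by lra.
  apply: (@real_affine_le _ (2 * b * nrm x.1 ^+ 2 - dissip F x)) => t.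
  have := Fb (x + (t%:C)%C *: e); rewrite aff /= scaler0 addr0; lra.
(* The direction x = F e + F^* e makes the slope a norm. *)
by apply/eqP; rewrite -addr_eq0; apply/eqP/Re_hdot_eq0/zero.
Qed.

Lemma tens_orth_total (z : T) :
  (forall (x : k) (u : h), '[tens (T := T) x u, z] = 0) -> z = 0.
Proof.
move=> zT; apply: hdot_eq0.
have : orth (cspan [set tens (T := T) x u | x in [set: k] & u in [set: h]]) z.
  by rewrite orth_cspan => _ [x _ [u _ <-]].
by apply; rewrite /= tens_total.
Qed.

(** The adjoints are moved across: <(I ⊗ <u|) N^* xi, y> = <xi, N (y ⊗ u)>. The
    range of (C - I)^* and the closed span are thereby eliminated. *)
Lemma orth_kp F (y : k) : orth (kp (blockN F + bop_id T)) y <->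
  forall u, blockN F (tens y u) = 0.
Proof.
rewrite /kp orth_cspan addrK; split=> [yo u|Ny z [_ [xi _ <-]] [u _ <-]].
  apply: hdot_eqP => xi; rewrite hdot0r -adjPr.
  have <- : '[tens_bra T u (adj (blockN F) xi), y] = '[adj (blockN F) xi, tens y u].
    by rewrite /tens_bra adjPr.
  by apply: yo; exists (adj (blockN F) xi) => //; exists u.
by rewrite /tens_bra adjPr /= adjPr Ny hdot0r.
Qed.

End generators.

Section gaussian_blocks.
Variables (R : realType) (k h : hilbertType R) (T : htensor k h).
Variable F : bop (hat T) (hat T).

Lemma gaussian_blocks eta : qcgen F -> blockN F eta = 0 ->
  blockM F eta = - adj (blockL F) eta /\ adj (blockN F) eta = 0.
Proof.
move=> qF Neta; have := gaussian_direction qF Neta.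
have -> : adj F (hinr eta) = (adj (blockL F) eta, adj (blockN F) eta).
  apply: hdot_eqP => -[u z]; rewrite -adjP [RHS]hdot_hsumE /= -!adjP /=.
  have -> : ((u, z) : hat T) = (hinl u : hat T) + (hinr z : hat T).
    by congr pair => /=; rewrite ?addr0 ?add0r.
  by rewrite bop_add hdotDl !hdot_hsumE /= !hdot0r !add0r.
move=> FE; rewrite /blockM /= FE; split=> //.
have : blockN F eta = - adj (blockN F) eta by rewrite {1}/blockN /= FE.
by rewrite Neta => /esym/eqP; rewrite oppr_eq0 => /eqP.
Qed.

End gaussian_blocks.

(** * Splitting the tensor product along an orthogonal decomposition *)

Section splitting.
Variables (R : realType) (k h : hilbertType R) (T : htensor k h).

Lemma orth_subtens (W : csub k) (z : T) : orth (subtens_csub T W) z <->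
  forall x u, csub_set W x -> '[tens (T := T) x u, z] = 0.
Proof.
rewrite /subtens_csub orth_cspan; split=> [zo x u Wx|zo _ [x Wx [u _ <-]]].
  by apply: zo; exists x => //; exists u.
exact: zo.
Qed.

Lemma orth_subtens0 (W : csub k) (z : T) :
  orth (subtens_csub T W) z <-> adj (cincl (subtens_csub T W)) z = 0.
Proof.
split=> [zo|z0 w Ww].
  by apply: hdot_eqP => w; rewrite -adjP hdot0r; apply: zo; exact: cvalP.
have -> : w = cincl (subtens_csub T W) (CSubType (mem_set Ww)) by [].
by rewrite adjP z0 hdot0r.
Qed.

(** By duality: the range of A^* is orthogonal to the simple tensors x ⊗ u, hence
    to their closed span W ⊗ h. *)
Lemma bop_subtens_eq0 (X : hilbertType R) (W : csub k) (A : bop T X) :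
  (forall x (u : h), csub_set W x -> A (tens x u) = 0) ->
  forall z, A (cincl (subtens_csub T W) z) = 0.
Proof.
move=> A0 z; apply: hdot_eqP => y; rewrite hdot0r -adjPr.
apply: hdot_eq0C.
have : orth (subtens_csub T W) (adj A y).
  apply/orth_subtens => x u Wx; by rewrite -adjP A0// hdot0l.
by apply; exact: cvalP.
Qed.

Lemma adj_cincl_tens (W : csub k) (x : csub_type W) (u : h) :
  adj (cincl (subtens_csub T W)) (tens (cval x) u) = subtens T x u.
Proof. by rewrite -[RHS](cincl_adjK). Qed.

Variable D : odecomp k.
Let J1 := cincl (subtens_csub T (odec1 D)).
Let J2 := cincl (subtens_csub T (odec2 D)).

Lemma orth_subtens_odec y u : csub_set (odec2 D) y ->
  orth (subtens_csub T (odec1 D)) (tens (T := T) y u).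
Proof.
by move=> Wy; apply/orth_subtens => x v Wx; rewrite tens_dot (odec_orth Wx Wy) mul0r.
Qed.

Lemma adj_odec1_tens y u : csub_set (odec2 D) y -> adj J1 (tens y u) = 0.
Proof. by move=> Wy; apply/orth_subtens0/orth_subtens_odec. Qed.

Lemma hdot_odec a b : '[J1 a, J2 b] = 0.
Proof.
have : orth (subtens_csub T (odec2 D)) (J1 a).
  by apply/orth_subtens => y u Wy; apply/hdot_eq0C/(orth_subtens_odec _ Wy)/cvalP.
by move=> /(_ _ (cvalP b))/hdot_eq0C.
Qed.

Lemma adj_odec12 b : adj J1 (J2 b) = 0.
Proof. by apply: hdot_eqP => a; rewrite -adjP hdot_odec hdot0r. Qed.

Lemma adj_odec21 a : adj J2 (J1 a) = 0.
Proof. by apply: hdot_eqP => b; rewrite -adjP hdot0r; apply/hdot_eq0C/hdot_odec. Qed.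

(** The difference of the two sides is orthogonal to both k1 ⊗ h and k2 ⊗ h, hence
    to every simple tensor. *)
Lemma odec_resolution z : J1 (adj J1 z) + J2 (adj J2 z) = z.
Proof.
pose w := J1 (adj J1 z) + J2 (adj J2 z) - z.
have w1 : orth (subtens_csub T (odec1 D)) w.
  by apply/orth_subtens0; rewrite bop_sub bop_add cincl_adjK adj_odec12 addr0 subrr.
have w2 : orth (subtens_csub T (odec2 D)) w.
  by apply/orth_subtens0; rewrite bop_sub bop_add cincl_adjK adj_odec21 add0r subrr.
apply/eqP; rewrite -subr_eq0 -/w; apply/eqP/tens_orth_total => x u.
have [x1 W1 [x2 W2 ->]] := odec_sum D x.
move/orth_subtens: w1 => /(_ _ u W1) e1; move/orth_subtens: w2 => /(_ _ u W2) e2.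
by rewrite linearDl hdotDl e1 e2 addr0.
Qed.

Lemma nrm_odec z : nrm z ^+ 2 = nrm (adj J1 z) ^+ 2 + nrm (adj J2 z) ^+ 2.
Proof.
by rewrite -{1}[z]odec_resolution nrmD_sqr hdot_odec mulr0 addr0.
Qed.

Lemma orth_odec1 : orth (odec1 D) = csub_set (odec2 D).
Proof.
apply/seteqP; split=> y; last by move=> Wy x Wx; exact: odec_orth Wx Wy.
have [x Wx [y' Wy' ->]] := odec_sum D y.
move=> /(_ x Wx); rewrite hdotDr (odec_orth Wx Wy') addr0 => /hdot_eq0 ->.
by rewrite add0r.
Qed.

End splitting.

Lemma odecomp_eqP (R : realType) (k : hilbertType R) (D D' : odecomp k) :
  odec1 D = odec1 D' -> D = D'.
Proof.
move=> e1; have e2 : odec2 D = odec2 D'.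
  by apply/csub_eqP; rewrite -!orth_odec1 e1.
case: D D' e1 e2 => [W1 W2 o s] [W1' W2' o' s'] /= e1 e2; subst W1' W2'.
by congr ODecomp; exact: Prop_irrelevance.
Qed.

Definition orth_odecomp (R : realType) (k : hilbertType R) (W : csub k) : odecomp k :=
  @ODecomp R k W (orth_csub W) (fun x y Wx Wy => Wy x Wx)
    (orthogonal_decomposition W).

(** * Compressions of a generator *)

Section gaussian_generator.
Variables (R : realType) (k h : hilbertType R) (T : htensor k h).

Definition gaussian_gen (L : bop h T) : bop (hat T) (hat T) :=
  block (- 2^-1 *: (adj L ∘ L)) (- adj L) L 0.

Lemma gaussian_gen_pure (L : bop h T) : pure_Gaussian (gaussian_gen L).
Proof.
split; last by exists L.
apply/qcgenP; exists 0 => // x.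
rewrite mulr0 mul0r /dissip /gaussian_gen hdot_hsumE block1E block2E.
rewrite bopZE bopNE bop_compE bop0E addr0 hdotDl hdotZl hdotNl !adjPr.
rewrite -nrm_sqr (hdot_conj x.2).
have -> : - 2^-1 = ((- 2^-1 : R)%:C)%C :> R[i].
  by rewrite rmorphN fmorphV rmorph_nat.
move: '[L x.1, x.2] (nrm (L x.1)) => [a a'] r /=; lra.
Qed.

End gaussian_generator.

Section compressions.
Variables (R : realType) (k h : hilbertType R) (T : htensor k h).
Variables (F : bop (hat T) (hat T)) (D : odecomp k).
Local Notation T1 := (subtensor T (odec1 D)).
Local Notation T2 := (subtensor T (odec2 D)).
Let J1 : bop T1 T := cincl (subtens_csub T (odec1 D)).
Let J2 : bop T2 T := cincl (subtens_csub T (odec2 D)).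

Definition gaussian_part : bop (hat T2) (hat T2) :=
  gaussian_gen (adj J2 ∘ blockL F).

Definition nonGaussian_part : bop (hat T1) (hat T1) :=
  block (blockK F + 2^-1 *: (adj (adj J2 ∘ blockL F) ∘ (adj J2 ∘ blockL F)))
    (blockM F ∘ J1) (adj J1 ∘ blockL F) (adj J1 ∘ blockN F ∘ J1).

Lemma adj_compl u : adj (adj J2 ∘ blockL F) u = adj (blockL F) (J2 u).
Proof. by apply: hdot_eqP => x; rewrite -!adjP !bop_compE adjPr. Qed.

(** The pure Gaussian shape has L_2 as its only parameter, and L_2 is read off from
    F by compressing; K_1 is then what is left of K, and the other blocks of the
    first component are compressions. *)
Lemma boxplus_parts (G1 : bop (hat T1) (hat T1)) (G2 : bop (hat T2) (hat T2)) :
  pure_Gaussian G2 -> F = boxplus G1 G2 ->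
  G1 = nonGaussian_part /\ G2 = gaussian_part.
Proof.
move=> [_ [L G2E]] FE.
have LE : adj J2 ∘ blockL F = L.
  apply/bopP => u; rewrite FE /boxplus blockLE G2E blockLE.
  by rewrite bop_compE bopDE !bop_compE bop_add adj_odec21 add0r cincl_adjK.
split; last by rewrite /gaussian_part LE.
rewrite [LHS]block_eta /nonGaussian_part LE.
apply: block_congr.
- by rewrite FE /boxplus blockKE G2E blockKE scaleNr subrK.
- apply/bopP => z; rewrite FE /boxplus blockME bop_compE bopDE !bop_compE.
  by rewrite cincl_adjK adj_odec21 bop0 addr0.
- apply/bopP => u; rewrite FE /boxplus blockLE bop_compE bopDE !bop_compE.
  by rewrite bop_add cincl_adjK adj_odec12 addr0.
- apply/bopP => z; rewrite FE /boxplus blockNE bop_compE bop_compE bopDE.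
  by rewrite !bop_compE bop_add !cincl_adjK adj_odec12 addr0.
Qed.

(** The two closed subspaces are compared through their complements, which are
    both described by the vanishing of N on y ⊗ h. *)
Lemma boxplus_kp (G1 : bop (hat T1) (hat T1)) (G2 : bop (hat T2) (hat T2)) :
  wholly_nonGaussian G1 -> pure_Gaussian G2 -> F = boxplus G1 G2 ->
  odec1 D = kp (blockN F + bop_id T).
Proof.
move=> [_ /csub_setTP kp1] [_ [L G2E]] FE.
have NE z : blockN F z = J1 (blockN G1 (adj J1 z)).
  rewrite FE /boxplus blockNE G2E blockNE bopDE !bop_compE bop0E.
  by rewrite bop0 addr0.
have N0 y u : csub_set (odec2 D) y -> blockN F (tens y u) = 0.
  by move=> Wy; rewrite NE (adj_odec1_tens T u Wy) !bop0.
apply/csub_orth_inj/seteqP; split=> y.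
  by rewrite orth_odec1 => Wy; apply/orth_kp => u; exact: N0.
move/orth_kp; have [x Wx [y' Wy' ->]] := odec_sum D y => Nxy.
suff x0 : x = 0 by rewrite x0 add0r orth_odec1.
pose x1 := CSubType (mem_set Wx) : csub_type (odec1 D).
suff : orth (kp (blockN G1 + bop_id T1)) x1.
  by move=> /kp1/= x10; rewrite -[x]/(cval x1) x10.
apply/orth_kp => u; have := Nxy u.
rewrite linearDl bop_add (N0 y')// addr0 NE -[x]/(cval x1) adj_cincl_tens.
by move=> e; rewrite -[LHS]cincl_adjK [cincl _ _]e bop0.
Qed.

End compressions.

(** * Existence and uniqueness *)

Section existence.
Variables (R : realType) (k h : hilbertType R) (T : htensor k h).
Variables (F : bop (hat T) (hat T)) (hF : qcgen F).

Let D := orth_odecomp (kp (blockN F + bop_id T)).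
Local Notation T1 := (subtensor T (odec1 D)).
Local Notation T2 := (subtensor T (odec2 D)).
Let J1 : bop T1 T := cincl (subtens_csub T (odec1 D)).
Let J2 : bop T2 T := cincl (subtens_csub T (odec2 D)).

Lemma blockN_J2 z : blockN F (J2 z) = 0.
Proof. by apply: bop_subtens_eq0 => x u Wx; have /orth_kp -> := Wx. Qed.

Lemma blockM_J2 z : blockM F (J2 z) = - adj (blockL F) (J2 z).
Proof. by have [] := gaussian_blocks hF (blockN_J2 z). Qed.

Lemma adj_J2_blockN z : adj J2 (blockN F z) = 0.
Proof.
apply: hdot_eqP => w; rewrite -adjP -adjPr.
by have [_ ->] := gaussian_blocks hF (blockN_J2 w); rewrite hdot0l hdot0r.
Qed.

Lemma blockN_J1 z : blockN F (J1 (adj J1 z)) = blockN F z.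
Proof.
by rewrite -{2}[z](odec_resolution D) bop_add blockN_J2 addr0.
Qed.

Lemma adj_J1_blockN z : J1 (adj J1 (blockN F z)) = blockN F z.
Proof.
by rewrite -[RHS](odec_resolution D) adj_J2_blockN bop0 addr0.
Qed.

Lemma boxplus_canonical : F = boxplus (nonGaussian_part F D) (gaussian_part F D).
Proof.
rewrite [LHS]block_eta /boxplus !blockKE !blockME !blockLE !blockNE.
apply: block_congr.
- by rewrite scaleNr addrK.
(* The blocks of F are themselves compositions, so the right-hand sides are put
   in the required form by conversion: rewriting with bop_compE would unfold them. *)
- apply/bopP => z; rewrite -[RHS]/(blockM F (J1 (adj J1 z))
    - adj (adj J2 ∘ blockL F) (adj J2 z)) adj_compl.
  by rewrite -blockM_J2 -bop_add odec_resolution.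
- by apply/bopP => u; rewrite bopDE !bop_compE odec_resolution.
- apply/bopP => z.
  rewrite -[RHS]/(J1 (adj J1 (blockN F (J1 (adj J1 z)))) + J2 0).
  by rewrite blockN_J1 adj_J1_blockN bop0 addr0.
Qed.

(** The form of the first component at x equals the form of F at (x.1, J1 x.2), with
    the same constant b. *)
Lemma nonGaussian_part_qcgen : qcgen (nonGaussian_part F D).
Proof.
have /qcgenP[b b0 Fb] := hF; apply/qcgenP; exists b => // x.
apply: le_trans (Fb ((x.1, J1 x.2) : hat T)).
pose Fy := F ((x.1, J1 x.2) : hat T).
have Fy1 : Fy.1 = blockK F x.1 + blockM F (J1 x.2).
  by rewrite /Fy {1}[F]block_eta blockE.
have Fy2 : Fy.2 = blockL F x.1 + blockN F (J1 x.2).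
  by rewrite /Fy {1}[F]block_eta blockE.
pose A : bop h T2 := adj J2 ∘ blockL F.
have J2Fy : adj J2 Fy.2 = A x.1 by rewrite Fy2 bop_add adj_J2_blockN addr0.
have G1 : (nonGaussian_part F D x).1 = Fy.1 + 2^-1 *: adj A (A x.1).
  by rewrite block1E Fy1 addrAC.
have G2 : (nonGaussian_part F D x).2 = adj J1 Fy.2.
  by rewrite block2E Fy2 bop_add.
rewrite /dissip -/Fy (nrm_odec D) J2Fy !hdot_hsumE G1 G2.
rewrite [in leLHS]hdotDl hdotZl (adjPr A) (adjPr J1) -nrm_sqr.
have -> : 2^-1 = ((2^-1 : R)%:C)%C :> R[i] by rewrite fmorphV rmorph_nat.
rewrite /=; move: '[Fy.1, x.1] '[Fy.2, J1 x.2] => [a a'] [c c'] /=; lra.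
Qed.

Lemma nonGaussian_part_wholly : wholly_nonGaussian (nonGaussian_part F D).
Proof.
split; first exact: nonGaussian_part_qcgen.
apply/csub_setTP => y /orth_kp; rewrite blockNE => Ny.
apply/val_inj/hdot_eq0; suff : orth (odec1 D) (cval y) by apply; exact: cvalP.
apply/orth_kp => u; rewrite -adj_J1_blockN -blockN_J1.
by rewrite adj_cincl_tens [adj J1 _]Ny bop0.
Qed.

End existence.

Theorem theorem4p3 (R : realType) (k h : hilbertType R) (T : htensor k h)
    (F : bop (hat T) (hat T)) (hF : qcgen F) :
  exists! d : concat_data T,
    [/\ wholly_nonGaussian (cd_fst d), pure_Gaussian (cd_snd d)
      & F = boxplus (cd_fst d) (cd_snd d)].
Proof.
pose D := orth_odecomp (kp (blockN F + bop_id T)).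
exists (ConcatData (nonGaussian_part F D) (gaussian_part F D)); split=> /=.
  split; first exact: nonGaussian_part_wholly.
    exact: gaussian_gen_pure.
  exact: boxplus_canonical.
move=> [D' G1 G2] /= [G1w G2p FE].
have DD' : D = D' by apply: odecomp_eqP; exact/esym/(boxplus_kp G1w G2p FE).
case: D' / DD' G1 G2 G1w G2p FE => G1 G2 _ G2p FE.
by have [-> ->] := boxplus_parts G2p FE.
Qed.
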